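(* Let $\{E_\alpha:\alpha\in A\}$ be any family of Banach spaces. Then the $\Sigma$-product $Y$ of $\{E_\alpha:\alpha\in A\}$ with base point $0$ is an Asplund locally convex space if and only if each $E_\alpha$ is Asplund.
   Context: All vector spaces are over $\mathbb{R}$ and all topological vector spaces are Hausdorff. A subset of a topological vector space is bounded if it is absorbed by every neighbourhood of $0$. The $\Sigma$-product with base point $0$ of a family $\{E_\alpha:\alpha\in A\}$ of locally convex spaces is the subspace of $\prod_{\alpha\in A}E_\alpha$ consisting of all $x=(x_\alpha)$ with $x_\alpha=0$ for all but countably many $\alpha$, with the topology induced from the product topology; it is a locally convex space. Let $X$ be a locally convex space with continuous dual $X'$ and let $D\subset X$ be a nonempty open convex set. A convex function $f:D\to\mathbb{R}$ is Fréchet differentiable at $x_0\in D$ if there is a continuous linear functional $f'(x_0)\in X'$ such that for every bounded set $B\subset X$ and every $\epsilon>0$ there is $\delta>0$ such that $\sup_{x\in B}\left|\frac{f(x_0+tx)-f(x_0)}{t}-\langle f'(x_0),x\rangle\right|<\epsilon$ whenever $0<|t|<\delta$ (with $\delta$ small enough that $x_0+tx\in D$ for all $x\in B$). A locally convex space $X$ (in particular a Banach space) is Asplund (ASP) if for every nonempty open convex $D\subset X$, every continuous convex function $f:D\to\mathbb{R}$ is Fréchet differentiable at every point of some dense $G_\delta$ subset of $D$. *)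

(* Defs.v *)
From HB Require Import structures.
From mathcomp Require Import all_boot all_order all_algebra.
From mathcomp Require Import all_classical all_reals all_analysis.
From mathcomp Require Import borel_hierarchy.

Set Implicit Arguments.
Unset Strict Implicit.
Unset Printing Implicit Defensive.

Import Order.TTheory GRing.Theory Num.Theory.
Import numFieldTopology.Exports numFieldNormedType.Exports.

Local Open Scope classical_set_scope.
Local Open Scope ring_scope.

(* [prod_topology E] is the dependent product [forall i, E i], which the library
   equips with the product topology but not with an algebraic structure. *)
Section prod_lmodule.
Context (I : Type).

Section prod_nmodule.
Context (E : I -> nmodType).
Implicit Types x y z : prod_topology E.

Let add x y : prod_topology E := fun i => x i + y i.

Let addA : associative add.
Proof. by move=> x y z; apply: functional_extensionality_dep => i; exact: addrA. Qed.

Let addC : commutative add.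
Proof. by move=> x y; apply: functional_extensionality_dep => i; exact: addrC. Qed.

Let add0 : left_id (fun i => 0 : E i) add.
Proof. by move=> x; apply: functional_extensionality_dep => i; exact: add0r. Qed.

HB.instance Definition _ :=
  GRing.isNmodule.Build (prod_topology E) addA addC add0.

End prod_nmodule.

Section prod_zmodule.
Context (E : I -> zmodType).

Let opp (x : prod_topology E) : prod_topology E := fun i => - x i.

Let addN : left_inverse 0 opp +%R.
Proof. by move=> x; apply: functional_extensionality_dep => i; exact: addNr. Qed.

HB.instance Definition _ := GRing.Nmodule_isZmodule.Build (prod_topology E) addN.

End prod_zmodule.

Section prod_scale.
Context (R : pzRingType) (E : I -> lmodType R).
Implicit Types x y : prod_topology E.

Let scale (k : R) x : prod_topology E := fun i => k *: x i.

Let scaleA k l x : scale k (scale l x) = scale (k * l) x.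
Proof. by apply: functional_extensionality_dep => i; exact: scalerA. Qed.

Let scale1 : left_id 1 scale.
Proof. by move=> x; apply: functional_extensionality_dep => i; exact: scale1r. Qed.

Let scaleDr : right_distributive scale +%R.
Proof. by move=> k x y; apply: functional_extensionality_dep => i; exact: scalerDr. Qed.

Let scaleDl x : {morph scale^~ x : k l / k + l}.
Proof. by move=> k l; apply: functional_extensionality_dep => i; exact: scalerDl. Qed.

HB.instance Definition _ := GRing.Zmodule_isLmodule.Build R (prod_topology E)
  scaleA scale1 scaleDr scaleDl.

End prod_scale.
End prod_lmodule.


Section prod_tvs.
Context (R : realType) (I : Type) (E : I -> tvsType R).
Local Notation P := (prod_topology E).

HB.instance Definition _ := GRing.Lmodule.on P.

Lemma cvg_prod_topology (F : set_system P) (x : P) : Filter F ->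
  F --> x <-> forall i, (fun y : P => y i) @ F --> x i.
Proof.
move=> FF; split=> [Fx i|Fx].
  have [/(_ Fx) Fi _] := cvg_sup
    (fun i => Topological.class (initial_topology (fun y : P => y i))) x FF.
  move=> U; rewrite nbhsE => -[V [oV Vx] VU].
  apply: (Fi i); exists ((fun y : P => y i) @^-1` V).
  by split => //; [exists V|move=> y; exact: VU].
apply/cvg_sup => i U [_ [[V oV <-] /= Vx] VU].
apply: (filterS VU); apply: (Fx i V); exact: open_nbhs_nbhs.
Qed.

Lemma prod_topology_proj_continuous i : continuous (fun x : P => x i).
Proof.
by move=> x; have [+ _] := @cvg_prod_topology (nbhs x) x _; apply; exact: cvg_id.
Qed.

Let prod_add_continuous : continuous (fun x : P * P => x.1 + x.2).
Proof.
move=> x; apply/cvg_prod_topology => i.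
apply: (@continuous2_cvg _ _ _ _ (nbhs x) _
  (fun y : P * P => y.1 i) (fun y => y.2 i) +%R).
- exact: (@add_continuous _ (x.1 i, x.2 i)).
- apply: (@cvg_comp _ _ _ (fun y => y.1) (fun y : P => y i)); first exact: cvg_fst.
  exact: prod_topology_proj_continuous.
- apply: (@cvg_comp _ _ _ (fun y => y.2) (fun y : P => y i)); first exact: cvg_snd.
  exact: prod_topology_proj_continuous.
Qed.

Let prod_scale_continuous : continuous (fun z : R^o * P => z.1 *: z.2).
Proof.
move=> x; apply/cvg_prod_topology => i.
apply: (@continuous2_cvg _ _ _ _ (nbhs x) _
  (fun y : R^o * P => y.1) (fun y => y.2 i) ( *:%R : R^o -> _ -> _)).
- exact: (@scale_continuous _ _ (x.1, x.2 i)).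
- exact: cvg_fst.
- apply: (@cvg_comp _ _ _ (fun y => y.2) (fun y : P => y i)); first exact: cvg_snd.
  exact: prod_topology_proj_continuous.
Qed.

Let prod_locally_convex :
  exists2 B : set_system P, (forall b, b \in B -> convex_set b) & basis B.
Proof.
exists [set b | open b /\ convex_set b]; first by move=> b /set_mem[].
split=> [b []//|x].
have FF : Filter (filter_from
    [set U : set P | (open U /\ convex_set U) /\ U x] id).
  apply: filter_from_filter.
    exists setT; split => //; split; first exact: openT.
    by move=> y z l _ _; rewrite inE.
  move=> U V [[oU cU] Ux] [[oV cV] Vx]; exists (U `&` V) => //.
  split; last by split.
  split; first exact: openI.
  move=> y z l; rewrite !in_setI => /andP[Uy Vy] /andP[Uz Vz].
  by rewrite cU ?cV.
apply/cvg_prod_topology => i U xU.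
have [B cB [oB /(_ (x i))]] := @locally_convex R (E i).
move=> /(_ U xU) [V [BV Vx] VU].
exists ((fun y : P => y i) @^-1` V); last by move=> y /VU.
split=> //; split.
  move/continuousP : (@prod_topology_proj_continuous i); apply.
  exact: oB.
move=> y z l /set_mem Vy /set_mem Vz; apply/mem_set.
apply/set_mem; apply: (cB V _ (y i) (z i) l); exact/mem_set.
Qed.

HB.instance Definition _ :=
  PreTopologicalNmodule_isTopologicalNmodule.Build P prod_add_continuous.
HB.instance Definition _ :=
  TopologicalNmodule_isTopologicalLmodule.Build R P prod_scale_continuous.
HB.instance Definition _ := Uniform_isTvs.Build R P prod_locally_convex.

End prod_tvs.

Section sigma_product.
Context (R : realType) (I : Type) (E : I -> tvsType R).
Local Notation P := (prod_topology E).

(* The Sigma-product with base point 0: the subspace of the product formed by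
   the countably supported families; [countable] includes finite sets. *)
Definition sigma_pred : {pred P} :=
  mem [set x : P | countable [set i | x i != 0]].

Let sigma_pred_submod_closed : submod_closed sigma_pred.
Proof.
split.
  rewrite inE /=; apply: sub_countable (countable0 I).
  by apply: subset_card_le => i /=; rewrite eqxx.
move=> a x y /set_mem /= cx /set_mem /= cy; apply/mem_set => /=.
have cU : countable (\bigcup_(b in [set: bool])
    if b then [set i | x i != 0] else [set i | y i != 0]).
  by apply: bigcup_countable => // -[].
apply: sub_countable cU; apply: subset_card_le => i /=.
have [x0|] := eqVneq (x i) 0; last by exists true.
move=> xy; exists false => //=; apply: contra_neq xy => y0.
by rewrite /GRing.add /= /GRing.scale /= x0 y0 scaler0 addr0.
Qed.

HB.instance Definition _ :=
  GRing.isSubmodClosed.Build R P sigma_pred sigma_pred_submod_closed.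

Record sigma_product := SigmaProduct {
  sigma_val :> P ;
  sigma_valP : sigma_val \in sigma_pred
}.
Local Notation Y := sigma_product.

HB.instance Definition _ := [isSub for sigma_val].
HB.instance Definition _ := [Choice of Y by <:].
HB.instance Definition _ := [SubChoice_isSubLmodule of Y by <:].
HB.instance Definition _ := Uniform.copy Y (initial_topology sigma_val).

Lemma sigma_val_continuous : continuous (sigma_val : Y -> P).
Proof. exact: initial_continuous. Qed.

Let cvg_sigma (F : set_system Y) (x : Y) : Filter F ->
  sigma_val @ F --> sigma_val x -> F --> x.
Proof.
move=> FF Fx U [_ [[V oV <-] /= Vx] VU].
apply: (filterS VU); apply: (Fx V); exact: open_nbhs_nbhs.
Qed.

Let sigma_add_continuous : continuous (fun x : Y * Y => x.1 + x.2).
Proof.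
move=> x; apply: cvg_sigma.
apply: (@continuous2_cvg _ _ _ _ (nbhs x) _
  (fun y : Y * Y => sigma_val y.1) (fun y => sigma_val y.2) +%R).
- exact: (@add_continuous _ (sigma_val x.1, sigma_val x.2)).
- apply: (@cvg_comp _ _ _ (fun y : Y * Y => y.1) sigma_val);
    first exact: cvg_fst.
  exact: sigma_val_continuous.
- apply: (@cvg_comp _ _ _ (fun y : Y * Y => y.2) sigma_val);
    first exact: cvg_snd.
  exact: sigma_val_continuous.
Qed.

Let sigma_scale_continuous : continuous (fun z : R^o * Y => z.1 *: z.2).
Proof.
move=> x; apply: cvg_sigma.
apply: (@continuous2_cvg _ _ _ _ (nbhs x) _
  (fun y : R^o * Y => y.1) (fun y => sigma_val y.2) ( *:%R : R^o -> _ -> _)).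
- exact: (@scale_continuous _ _ (x.1, sigma_val x.2)).
- exact: cvg_fst.
- apply: (@cvg_comp _ _ _ (fun y : R^o * Y => y.2) sigma_val);
    first exact: cvg_snd.
  exact: sigma_val_continuous.
Qed.

Let sigma_locally_convex :
  exists2 B : set_system Y, (forall b, b \in B -> convex_set b) & basis B.
Proof.
have [B cB [oB Bx]] := @locally_convex R P.
exists [set sigma_val @^-1` b | b in B].
  move=> _ /set_mem[b /mem_set Bb <-] x y l /set_mem bx /set_mem bY.
  apply/mem_set/set_mem.
  by apply: (cB _ Bb (sigma_val x) (sigma_val y) l); exact/mem_set.
split=> [_ [b Bb <-]|x U [_ [[V oV <-] /= Vx] VU]].
  by exists b => //; exact: oB.
have /Bx[b [Bb bx] bV] : nbhs (sigma_val x) V by exact: open_nbhs_nbhs.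
exists (sigma_val @^-1` b); first by split => //; exists b.
by move=> y /bV Vy; exact: VU.
Qed.

HB.instance Definition _ :=
  PreTopologicalNmodule_isTopologicalNmodule.Build Y sigma_add_continuous.
HB.instance Definition _ :=
  TopologicalNmodule_isTopologicalLmodule.Build R Y sigma_scale_continuous.
HB.instance Definition _ := Uniform_isTvs.Build R Y sigma_locally_convex.

(* [tvsType] does not include separation. *)
Lemma sigma_product_hausdorff :
  (forall i, hausdorff_space (E i)) -> hausdorff_space Y.
Proof.
move=> hE x y xy; apply/val_inj/functional_extensionality_dep => i /=.
apply: hE => U V xU yV.
have cp (z : Y) W : nbhs (sigma_val z i) W ->
    nbhs z [set t : Y | W (sigma_val t i)].
  move=> zW; apply: (sigma_val_continuous (x := z)
    (t := [set t : P | W (t i)])).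
  exact: (prod_topology_proj_continuous (x := sigma_val z)).
by have [t [Ut Vt]] := xy _ _ (cp _ _ xU) (cp _ _ yV); exists (sigma_val t i).
Qed.

End sigma_product.

Section asplund.
Context (R : realType) (X : tvsType R).

(* [U] absorbs [B]. *)
Definition absorbs (U B : set X) :=
  exists2 r : R, 0 < r & forall s : R, r <= `|s| -> B `<=` [set s *: u | u in U].

(* Unlike the library's [bounded_set], this needs no norm. *)
Definition tvs_bounded (B : set X) := forall U, nbhs (0 : X) U -> absorbs U B.

(* A function on [D] is represented by a total function of which only the values
   on [D] are used. The supremum is taken in the extended reals: it is [+oo] on
   unbounded sets, whereas the supremum in [R] would be [0]. *)
Definition frechet_differentiable (D : set X) (f : X -> R^o) (x0 : X) :=
  exists2 f' : {linear X -> R^o}, continuous f' &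
    forall B, tvs_bounded B -> forall e : R, 0 < e ->
      exists2 delta : R, 0 < delta & forall t : R, 0 < `|t| < delta ->
        (forall x, B x -> D (x0 + t *: x)) /\
        (ereal_sup [set `|(f (x0 + t *: x) - f x0) / t - f' x|%:E | x in B]
          < e%:E)%E.

(* As [D] is open, a subset of [D] is a G_delta of the subspace [D] if and only
   if it is a G_delta of [X]. *)
Definition asplund_space :=
  forall D : set X, D !=set0 -> open D -> convex_set D ->
  forall f : X -> R^o, {within D, continuous f} -> convex_function D f ->
  exists G : set X, [/\ G `<=` D, D `<=` closure G, Gdelta G &
    forall x, G x -> frechet_differentiable D f x].

End asplund.

(* Main.v *)
(** The topology of the Sigma-product [Y] is given by the seminorms
[q F x = max_(a in F) |x a|] for finite [F]. A continuous convex function is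
locally bounded above on some cylinder [q F (z - x) < r], hence locally
[q F]-Lipschitz there, so locally it depends on the coordinates in [F] only. For
convex [f], Fréchet differentiability at [x] amounts to the second differences
[f (x + h) + f (x - h) - 2 f x] being [o(q F h)]; this condition, for a fixed
[epsilon], is open, which produces a G_delta. Convexity also gives
[f (x + h + k) <= (f (x + 2 h) + f (x + 2 k)) / 2], so smoothness along each of
the finitely many axes in [F] implies joint smoothness. Each axis condition holds
on a dense set because the factor is Asplund, and it is open in all coordinates
jointly; as [q F] is a complete seminorm, the Baire argument yields a dense set of
points that are smooth along all axes in [F]. Conversely, a convex function on
[E a] is differentiable at [y a] if its composition with the projection is
differentiable at [y]. *)

From HB Require Import structures.
Require Import Defs.
From mathcomp Require Import all_boot all_order all_algebra.
From mathcomp Require Import all_classical all_reals all_analysis.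
From mathcomp Require Import borel_hierarchy.
From mathcomp Require Import ring lra.

Set Implicit Arguments.
Unset Strict Implicit.
Unset Printing Implicit Defensive.

Import Order.TTheory GRing.Theory Num.Theory.
Import numFieldTopology.Exports numFieldNormedType.Exports.

Local Open Scope classical_set_scope.
Local Open Scope ring_scope.

(** * Convex functions and seminorms *)

Section convexity.
Context (R : realType) (V : lmodType R).
Implicit Types (D : set V) (f : V -> R).

(** Convexity is restated with a real weight and explicit bounds, so that the weights can be
    computed with freely; [convex_setP] and [convex_functionP] give the translation. *)
Definition conv_comb (t : R) (x y : V) : V := t *: x + (1 - t) *: y.

Definition conv_closed D :=
  forall t x y, 0 <= t <= 1 -> D x -> D y -> D (conv_comb t x y).

Definition conv_le D f := forall t x y, 0 <= t <= 1 -> D x -> D y ->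
  f (conv_comb t x y) <= t * f x + (1 - t) * f y.

Lemma convex_setP D : convex_set D <-> conv_closed D.
Proof.
split=> [cD t x y /andP[t0 t1] Dx Dy|cD x y l /set_mem Dx /set_mem Dy].
  by apply/set_mem; apply: (cD x y (Itv01 t0 t1)); exact/mem_set.
by apply/mem_set; apply: (cD l%:num x y) => //; apply/andP; split.
Qed.

Lemma convex_functionP D (f : V -> R^o) : convex_function D f <-> conv_le D f.
Proof.
split=> [cf t x y /andP[t0 t1] Dx Dy|cf l x y /set_mem Dx /set_mem Dy].
  by apply: (cf (Itv01 t0 t1) x y); exact/mem_set.
by apply: (cf l%:num x y) => //; apply/andP; split.
Qed.

End convexity.

Section seminorm.
Context (R : realType) (V : lmodType R).

Definition seminorm (p : V -> R) :=
  (forall x y, p (x + y) <= p x + p y) /\ (forall a x, p (a *: x) = `|a| * p x).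

Context (p : V -> R).
Hypothesis sp : seminorm p.

Lemma seminormD x y : p (x + y) <= p x + p y. Proof. exact: sp.1. Qed.

Lemma seminormZ a x : p (a *: x) = `|a| * p x. Proof. exact: sp.2. Qed.

Lemma seminorm0 : p 0 = 0.
Proof. by rewrite -(scale0r 0) seminormZ normr0 mul0r. Qed.

Lemma seminormN x : p (- x) = p x.
Proof. by rewrite -scaleN1r seminormZ normrN1 mul1r. Qed.

Lemma seminormB x y : p (x - y) <= p x + p y.
Proof. by rewrite -(seminormN y) seminormD. Qed.

Lemma seminormBC x y : p (x - y) = p (y - x).
Proof. by rewrite -seminormN opprB. Qed.

Lemma seminorm_ge0 x : 0 <= p x.
Proof. have := seminormB x x; rewrite subrr seminorm0; lra. Qed.

Lemma seminorm_triangle y x z : p (x - z) <= p (x - y) + p (y - z).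
Proof. by rewrite (le_trans _ (seminormD _ _))// addrA subrK. Qed.

Definition cyl (x : V) (r : R) : set V := [set z | p (z - x) < r].

Lemma cyl_center x r : 0 < r -> cyl x r x.
Proof. by rewrite /cyl /= subrr seminorm0. Qed.

Lemma cyl_half x r : 0 < r -> cyl x (r / 2) `<=` cyl x r.
Proof.
by move=> r0 z /lt_trans; apply; rewrite ltr_pdivrMr// ltr_pMr// ltr1n.
Qed.

End seminorm.

Lemma conv_combD (R : realType) (V : lmodType R) (t : R) (x h k : V) :
  conv_comb t (x + h) (x + k) = x + conv_comb t h k.
Proof.
rewrite /conv_comb !scalerDr addrACA -scalerDl.
by rewrite [t + (1 - t)]addrC subrK scale1r.
Qed.

Lemma half_add (R : realType) (V : lmodType R) (x : V) : 2^-1 *: (x + x) = x.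
Proof. by rewrite -mulr2n -[x *+ 2]scaler_nat scalerA mulVf// scale1r. Qed.

Lemma le_eps_mul (R : realType) (a b K : R) : 0 <= K ->
  (forall e, 0 < e -> a <= b + e * K) -> a <= b.
Proof.
move=> K0 H; apply/ler_addgt0Pr => e e0.
apply: le_trans (H (e / (K + 1)) _) _; first by rewrite divr_gt0// ltr_wpDl.
by rewrite lerD2l mulrAC ler_pdivrMr ?ltr_wpDl// ler_pM2l// lerDl.
Qed.

Lemma small_mul (R : realType) (d K : R) : 0 < d -> 0 <= K ->
  exists2 t, 0 < t & t * K <= d.
Proof.
move=> d0 K0; exists (d / (K + 1)); first by rewrite divr_gt0// ltr_wpDl.
by rewrite mulrAC ler_pdivrMr ?ltr_wpDl// ler_pM2l// lerDl.
Qed.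

(** * Second differences of a convex function relative to one seminorm *)

Section convex_seminorm.
Context (R : realType) (V : lmodType R) (p : V -> R) (sp : seminorm p).
Context (D : set V) (f : V -> R).
Hypothesis cD : conv_closed D.
Hypothesis cf : conv_le D f.

Definition second_diff (x h : V) : R := f (x + h) + f (x - h) - 2 * f x.

Lemma convex_scale x h (s : R) : 0 <= s <= 1 -> D x -> D (x + h) ->
  D (x + s *: h) /\ f (x + s *: h) <= s * f (x + h) + (1 - s) * f x.
Proof.
move=> s01 Dx Dxh.
have -> : x + s *: h = conv_comb s (x + h) x.
  by rewrite -[X in conv_comb _ _ X]addr0 conv_combD /conv_comb scaler0 addr0.
by split; [exact: cD|exact: cf].
Qed.

Lemma convex_mid x y : D x -> D y ->
  D (2^-1 *: (x + y)) /\ f (2^-1 *: (x + y)) <= (f x + f y) / 2.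
Proof.
move=> Dx Dy.
have e : 1 - 2^-1 = 2^-1 :> R by field.
have -> : 2^-1 *: (x + y) = conv_comb 2^-1 x y by rewrite /conv_comb e scalerDr.
split; first by apply: cD => //; lra.
by apply: le_trans (cf _ Dx Dy) _; lra.
Qed.

Lemma convex_midD x h k : D (x + 2 *: h) -> D (x + 2 *: k) ->
  D (x + (h + k)) /\ f (x + (h + k)) <= (f (x + 2 *: h) + f (x + 2 *: k)) / 2.
Proof.
move=> Dh Dk; have := convex_mid Dh Dk.
suff -> : 2^-1 *: (x + 2 *: h + (x + 2 *: k)) = x + (h + k) by [].
rewrite addrACA -(scalerDr 2) [2^-1 *: _]scalerDr scalerA mulVf// scale1r.
by rewrite half_add.
Qed.

Lemma second_diff_scale x h (s : R) : 0 <= s <= 1 ->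
  D x -> D (x + h) -> D (x - h) ->
  [/\ D (x + s *: h), D (x - s *: h) & second_diff x (s *: h) <= s * second_diff x h].
Proof.
move=> s01 Dx Dh DNh.
have [D1 f1] := convex_scale s01 Dx Dh.
have [D2 f2] := convex_scale s01 Dx DNh.
rewrite scalerN in D2 f2; split => //; rewrite /second_diff; nra.
Qed.

Lemma second_diff_ge0 x h : D (x + h) -> D (x - h) -> 0 <= second_diff x h.
Proof.
move=> Dh DNh; have [_] := convex_mid Dh DNh.
rewrite addrACA subrr addr0 half_add.
rewrite /second_diff; lra.
Qed.

(* Fréchet smoothness up to [eps] in the directions of [H]; for convex [f] the
   second difference needs to be controlled on one ball only. *)
Definition smooth_along (H : set V) (eps : R) (x : V) :=
  exists2 d : R, 0 < d & forall h, H h -> p h <= d ->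
    [/\ D (x + h), D (x - h) & second_diff x h <= eps * d].

Lemma smooth_along_mono H eps eps' x : eps <= eps' ->
  smooth_along H eps x -> smooth_along H eps' x.
Proof.
move=> ee [d d0 Hd]; exists d => // h Hh ph; have [D1 D2 sd] := Hd h Hh ph.
by split=> //; apply: le_trans sd _; rewrite ler_pM2r.
Qed.

(** Along a ray, the second difference of a convex function grows at least linearly
    ([second_diff_scale]), so the bound at radius [d] scales down to every smaller radius. *)
Lemma smooth_along_shrink H eps x d d' :
  (forall c h, H h -> H (c *: h)) -> D x -> 0 < d' <= d ->
  (forall h, H h -> p h <= d ->
    [/\ D (x + h), D (x - h) & second_diff x h <= eps * d]) ->
  forall h, H h -> p h <= d' ->
    [/\ D (x + h), D (x - h) & second_diff x h <= eps * d'].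
Proof.
move=> HZ Dx /andP[d'0 d'd] Hd h Hh ph.
have d0 : 0 < d by lra.
have [||D1 D2 sd] := Hd ((d / d') *: h); first exact: HZ.
  rewrite (seminormZ sp) gtr0_norm ?divr_gt0//.
  by rewrite mulrAC ler_pdivrMr// ler_wpM2l// ltW.
have e : h = (d' / d) *: ((d / d') *: h).
  by rewrite scalerA mulrA divfK ?gt_eqF// divff ?gt_eqF// scale1r.
have s01 : 0 <= d' / d <= 1.
  by rewrite ler_pdivrMr// mul1r d'd divr_ge0// ltW.
have [D3 D4 sd'] := second_diff_scale s01 Dx D1 D2.
rewrite -e in D3 D4 sd'; split=> //; apply: (le_trans sd').
have -> : eps * d' = d' / d * (eps * d) by field; rewrite gt_eqF.
by rewrite ler_wpM2l// divr_ge0// ltW.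
Qed.

(** * Lipschitz bound and stability of smoothness on a cylinder where the function is bounded
    above *)

Section bounded_above.
Context (x : V) (r M : R).
Hypothesis r0 : 0 < r.
Hypothesis CD : cyl p x r `<=` D.
Hypothesis fM : forall z, cyl p x r z -> f z <= M.

Let Dx : D x. Proof. by apply: CD; exact: cyl_center. Qed.

Let sub w : cyl p x (r / 2) w -> D w. Proof. by move=> /(cyl_half r0)/CD. Qed.

(** Extend the segment from [v] to [u] beyond [u] to a point [w] of the cylinder. Convexity on the
    segment from [v] to [w] bounds the slope, given [f w <= M] and a lower bound for [f v]. *)
Lemma convex_lipschitz : exists2 L : R, 0 <= L &
  forall u v, cyl p x (r / 2) u -> cyl p x (r / 2) v ->
    f u - f v <= L * p (u - v).
Proof.
have Cx := cyl_center sp x r0; have fxM := fM Cx.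
have L0' : 0 <= 4 * (M - f x) by lra.
have L0 : 0 <= 4 * (M - f x) / r by rewrite divr_ge0// ltW.
exists (4 * (M - f x) / r) => // u v Cu Cv.
have half z := @cyl_half _ _ p x r r0 z.
(* Reflect [v] through the centre [x]: the second difference there is nonnegative. *)
have fv : 2 * f x - M <= f v.
  have e : x - (v - x) - x = - (v - x) by rewrite addrAC subrr add0r.
  have C' : cyl p x r (x - (v - x)).
    by rewrite /cyl /= e (seminormN sp); exact: half.
  have e2 : x + (v - x) = v by rewrite addrC subrK.
  have := @second_diff_ge0 x (v - x); rewrite /second_diff e2.
  by move=> /(_ (sub Cv) (CD C')); have := fM C'; lra.
apply/ler_addgt0Pr => e e0.
set K := 4 * _ / r in L0 *.
(* As [p (u - v)] may vanish, divide by a slightly larger positive [s] instead. *)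
have [s ps sL] : exists2 s : R, p (u - v) < s & K * s <= K * p (u - v) + e.
  exists (p (u - v) + e / (K + 1)).
    by rewrite ltrDl divr_gt0// ltr_wpDl.
  rewrite mulrDr lerD2l mulrA ler_pdivrMr ?ltr_wpDl//.
  by rewrite mulrC ler_pM2l// lerDl.
apply: le_trans sL; have s0 : 0 < s by apply: le_lt_trans ps; exact: seminorm_ge0.
pose t := s / (s + r / 2); have sr0 : 0 < s + r / 2 by rewrite addr_gt0// divr_gt0.
have sr0' : s + r / 2 != 0 by rewrite gt_eqF.
have t01 : 0 <= t <= 1.
  by rewrite ler_pdivrMr// mul1r lerDl !divr_ge0// ltW.
pose w := u + (r / 2 / s) *: (u - v).
have Cw : cyl p x r w.
  rewrite /cyl /= /w addrAC (le_lt_trans (seminormD sp _ _))// (seminormZ sp).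
  rewrite gtr0_norm ?divr_gt0// [ltRHS](splitr r) ltrD//.
  by rewrite [ltLHS]mulrAC ltr_pdivrMr// ltr_pM2l ?divr_gt0.
have e1 : u = conv_comb t w v.
  have -> : w = v + (1 + r / 2 / s) *: (u - v).
    by rewrite scalerDl scale1r addrA [v + _]addrC subrK.
  rewrite -[X in conv_comb _ _ X]addr0 conv_combD /conv_comb scaler0 addr0 scalerA.
  have -> : t * (1 + r / 2 / s) = 1.
    by rewrite /t; field; rewrite !gt_eqF ?addr_gt0 ?mulr_gt0.
  by rewrite scale1r addrC subrK.
have fu : f u <= t * f w + (1 - t) * f v.
  by rewrite {1}e1; apply: cf => //; [exact: CD|exact: sub].
have fw := fM Cw.
have fuv : f u - f v <= t * (2 * (M - f x)) by case/andP: t01 => *; nra.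
apply: (le_trans fuv); have -> : K * s = s / (r / 2) * (2 * (M - f x)).
  by rewrite /K; field; rewrite gt_eqF.
have fxM2 : 0 <= 2 * (M - f x) by lra.
by rewrite ler_wpM2r// ler_pM2l// lef_pV2 ?posrE ?divr_gt0// lerDr ltW.
Qed.

Lemma convex_cyl_eq u v : cyl p x (r / 2) u -> cyl p x (r / 2) v ->
  p (u - v) = 0 -> f u = f v.
Proof.
have [L L0 lipL] := convex_lipschitz => Cu Cv puv.
apply/le_anti/andP; split; rewrite -subr_le0.
  by apply: le_trans (lipL _ _ Cu Cv) _; rewrite puv mulr0.
by apply: le_trans (lipL _ _ Cv Cu) _; rewrite (seminormBC sp) puv mulr0.
Qed.

(** Replacing [x] by [z] changes the second difference by at most [4 * L * p (z - x)], which the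
    slack [(eps' - eps) * d] absorbs. The radius [d] is capped at [r / 4] to stay where the
    Lipschitz bound holds. *)
Lemma smooth_along_near H eps eps' : (forall c h, H h -> H (c *: h)) ->
  eps < eps' -> smooth_along H eps x ->
  exists2 eta, 0 < eta & forall z, cyl p x eta z -> smooth_along H eps' z.
Proof.
move=> HZ ee [d0 d0_gt0 Hd0].
have [L L0 lipL] := convex_lipschitz.
pose d := Num.min d0 (r / 4).
have d_gt0 : 0 < d by rewrite lt_min d0_gt0 divr_gt0.
have dd0 : 0 < d <= d0 by rewrite d_gt0 ge_min lexx.
have dr : d <= r / 4 by rewrite ge_min lexx orbT.
have Hd := smooth_along_shrink HZ Dx dd0 Hd0.
have e0 : 0 < eps' - eps by rewrite subr_gt0.
pose eta := Num.min (r / 4) ((eps' - eps) * d / (4 * L + 1)).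
have L1 : 0 < 4 * L + 1 by rewrite ltr_wpDl// mulr_ge0.
have eta0 : 0 < eta by rewrite lt_min !divr_gt0// mulr_gt0.
have etar : eta <= r / 4 by rewrite ge_min lexx.
have etaL : 4 * L * eta <= (eps' - eps) * d.
  have : eta <= (eps' - eps) * d / (4 * L + 1) by rewrite ge_min lexx orbT.
  by rewrite ler_pdivlMr// => h; nra.
exists eta => // z Cz; exists d => // h Hh ph.
have Ch w k : p (w - x) < eta -> p k <= d -> cyl p x (r / 2) (w + k).
  move=> wx pk; rewrite /cyl /= addrAC (le_lt_trans (seminormD sp _ _))//.
  have -> : r / 2 = r / 4 + r / 4 by field.
  by rewrite ltr_leD ?(lt_le_trans wx)// (le_trans pk).
have xx : p (x - x) < eta by rewrite subrr (seminorm0 sp).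
have phN : p (- h) <= d by rewrite (seminormN sp).
have p0 : p 0 <= d by rewrite (seminorm0 sp) ltW.
have C1 := Ch _ _ Cz ph; have C2 := Ch _ _ Cz phN; have C3 := Ch _ _ Cz p0.
have C4 := Ch _ _ xx ph; have C5 := Ch _ _ xx phN; have C6 := Ch _ _ xx p0.
split; [exact: sub|exact: sub|].
have [_ _] := Hd h Hh ph; rewrite /second_diff => sd.
have l1 := lipL _ _ C1 C4; have l2 := lipL _ _ C2 C5; have l3 := lipL _ _ C6 C3.
have e1 k : z + k - (x + k) = z - x by rewrite opprD addrACA subrr addr0.
rewrite e1 in l1; rewrite e1 in l2.
rewrite !addr0 (seminormBC sp) in l3.
have lz : 4 * (L * p (z - x)) <= 4 * L * eta.
  by rewrite mulrA ler_wpM2l ?mulr_ge0// ltW.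
lra.
Qed.

(** Shrink the radius to [p h]. If [p h = 0] this is not a valid radius, and letting the radius tend
    to 0 gives the bound 0. *)
Lemma smooth_along_le eps : 0 <= eps -> smooth_along setT eps x ->
  exists2 d, 0 < d & forall h, p h <= d ->
    [/\ D (x + h), D (x - h) & second_diff x h <= eps * p h].
Proof.
move=> e0 [d0 d0_gt0 Hd0].
have HT (c : R) (h : V) : [set: V] h -> [set: V] (c *: h) by [].
have Hd d (dd : 0 < d <= d0) := smooth_along_shrink HT Dx dd Hd0.
exists d0 => // h ph; have [D1 D2 sd] := Hd0 h I ph; split=> //.
have [p0|p0] := ltP 0 (p h).
  have pd : 0 < p h <= d0 by rewrite p0.
  by have [] := Hd _ pd h I (lexx _).
have {}p0 : p h = 0 by apply/le_anti; rewrite p0 (seminorm_ge0 sp).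
rewrite p0 mulr0; apply/ler_addgt0Pr => e e_gt0; rewrite add0r.
have [c /andP[c0 cd] ce] : exists2 c : R, 0 < c <= d0 & eps * c <= e.
  exists (Num.min d0 (e / (eps + 1))).
    by rewrite ge_min lexx lt_min d0_gt0 divr_gt0// ltr_wpDl.
  have h1 : Num.min d0 (e / (eps + 1)) <= e / (eps + 1) by rewrite ge_min lexx orbT.
  apply: (@le_trans _ _ (eps * (e / (eps + 1)))); first by rewrite ler_wpM2l.
  by rewrite mulrA ler_pdivrMr ?ltr_wpDl// mulrC ler_pM2l// lerDl.
have pc : p h <= c by rewrite p0 ltW.
have cd' : 0 < c <= d0 by rewrite c0.
by apply: le_trans ce; have [] := Hd c cd' h I pc.
Qed.

(** * The derivative at a point where second differences are [o(p h)] *)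

Section derivative.
Hypothesis smx : forall eps, 0 < eps -> smooth_along setT eps x.

Let quot h t := (f (x + t *: h) - f x) / t.
(** The one-sided directional derivative at [x]; the condition on [t] keeps the points inside the
    cylinder. *)
Let g h := inf [set quot h t | t in [set t | 0 < t /\ p (t *: h) < r / 2]].

Let xcyl h : p h < r / 2 -> cyl p x (r / 2) (x + h).
Proof. by rewrite /cyl /= addrAC subrr add0r. Qed.

(** Every backward quotient lies below every forward one, so [g h] lies between the two at step [t].
    Their gap is the second difference divided by [t], hence at most [eps * p h]. *)
Let g_approx eps : 0 < eps -> exists2 d, 0 < d & forall h t, 0 < t ->
  t * p h <= d -> [/\ cyl p x (r / 2) (x + t *: h), D (x - t *: h),
    second_diff x (t *: h) <= eps * t * p h,
    t * g h <= f (x + t *: h) - f x &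
    f (x + t *: h) - f x <= t * g h + eps * t * p h].
Proof.
move=> e0; have [d0 d0_gt0 Hd0] := smooth_along_le (ltW e0) (smx e0).
pose d := Num.min d0 (r / 4).
have d_gt0 : 0 < d by rewrite lt_min d0_gt0 divr_gt0.
have dr : d < r / 2.
  by rewrite gt_min; apply/orP; right; rewrite ltr_pM2l// ltf_pV2 ?posrE// ltr_nat.
exists d => // h t t0 pt.
have tp k : p (t *: k) = t * p k by rewrite (seminormZ sp) gtr0_norm.
have ptd0 : p (t *: h) <= d0 by rewrite tp (le_trans pt)// ge_min lexx.
have [D1 D2 sd] := Hd0 _ ptd0; rewrite tp mulrA in sd.
have valid : [set t | 0 < t /\ p (t *: h) < r / 2] t.
  by split => //; rewrite tp (le_lt_trans pt).
have lower s : 0 < s -> p (s *: h) < r / 2 ->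
    - (f (x - t *: h) - f x) / t <= quot h s.
  move=> s0 ps; rewrite /quot.
  have Ds := sub (xcyl ps).
  have st : 0 < s + t by rewrite addr_gt0.
  have st01 : 0 <= t / (s + t) <= 1.
    by rewrite ler_pdivrMr// mul1r lerDr divr_ge0 ?ltW.
  (* The weight [t / (s + t)] makes [x] the convex combination of [x + s *: h] and [x - t *: h]. *)
  have := cf st01 Ds D2; rewrite conv_combD /conv_comb scalerN !scalerA.
  have st0 : s + t != 0 by rewrite gt_eqF.
  have -> : (1 - t / (s + t)) * t = t / (s + t) * s by field.
  rewrite subrr addr0.
  have -> : t / (s + t) * f (x + s *: h) + (1 - t / (s + t)) * f (x - t *: h) =
    (t * f (x + s *: h) + s * f (x - t *: h)) / (s + t) by field.
  rewrite ler_pdivlMr// => H; rewrite ler_pdivrMr// mulrAC ler_pdivlMr//; lra.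
have lb : has_lbound [set quot h t | t in [set t | 0 < t /\ p (t *: h) < r / 2]].
  by exists (- (f (x - t *: h) - f x) / t) => _ [s [s0 ps] <-]; exact: lower.
have g1 : g h <= quot h t by apply: ge_inf => //; exists t.
have g2 : - (f (x - t *: h) - f x) / t <= g h.
  apply: lb_le_inf; first by exists (quot h t), t.
  by move=> _ [s [s0 ps] <-]; exact: lower.
rewrite ler_pdivrMr// in g2; rewrite ler_pdivlMr// in g1.
split => //; [by apply: xcyl; case: valid|by rewrite mulrC|].
move: sd; rewrite /second_diff; lra.
Qed.

(** Compare the midpoint inequality of [convex_midD] with the expansions at steps [t] and [t * 2],
    then let the relative error tend to 0. *)
Let gD h k : g (h + k) <= g h + g k.
Proof.
have p0 w : 0 <= p w := seminorm_ge0 sp w.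
have K0 : 0 <= p h + p k by rewrite addr_ge0.
apply: (le_eps_mul K0) => e e0; have [d d0 Hd] := g_approx e0.
have [t t0 tK] := small_mul d0 (mulr_ge0 (ler0n R 2) K0).
have t20 : 0 < t * 2 by rewrite mulr_gt0.
have ph := mulr_ge0 (ltW t0) (p0 h); have pk := mulr_ge0 (ltW t0) (p0 k).
have phk : t * p (h + k) <= t * (p h + p k).
  by rewrite ler_pM2l//; exact: seminormD.
have h1 : t * 2 * p h <= d by lra.
have h2 : t * 2 * p k <= d by lra.
have h3 : t * p (h + k) <= d by lra.
have [C1 _ _ _ u1] := Hd _ _ t20 h1; have [C2 _ _ _ u2] := Hd _ _ t20 h2.
have [_ _ _ l3 _] := Hd _ _ t0 h3.
rewrite ![t * 2]mulrC -!scalerA in C1 C2 u1 u2.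
have [_] := convex_midD (sub C1) (sub C2); rewrite -scalerDr => mid.
by rewrite -(ler_pM2l t0); lra.
Qed.

(** Vanishing second differences make the one-sided derivatives along [h] and [- h] cancel; with
    [gD] this yields additivity. *)
Let gN h : g (- h) = - g h.
Proof.
have p0 w : 0 <= p w := seminorm_ge0 sp w.
have K0 : 0 <= 2 * p h by rewrite mulr_ge0.
have key e : 0 < e -> `|g (- h) + g h| <= e * (2 * p h).
  move=> e0; have [d d0 Hd] := g_approx e0.
  have [t t0 tK] := small_mul d0 (p0 h).
  have [C1 D2 sd l1 u1] := Hd _ _ t0 tK.
  rewrite -(seminormN sp) in tK; have [C2 _ _ l2 u2] := Hd _ _ t0 tK.
  have := second_diff_ge0 (sub C1) D2; move: sd; rewrite /second_diff.
  rewrite scalerN (seminormN sp) in l2 u2 => sd0 sd.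
  by rewrite ler_norml; apply/andP; split; rewrite -(ler_pM2l t0); lra.
apply/eqP; rewrite -addr_eq0 -normr_eq0; apply/eqP/le_anti; rewrite normr_ge0 andbT.
by apply: (le_eps_mul K0) => e e0; rewrite add0r; exact: key.
Qed.

Let gZ c h : 0 < c -> g (c *: h) = c * g h.
Proof.
move=> c0; have p0 w : 0 <= p w := seminorm_ge0 sp w.
have pc : p (c *: h) = c * p h by rewrite (seminormZ sp) gtr0_norm.
have K0 : 0 <= c * p h by rewrite mulr_ge0// ltW.
apply/le_anti/andP; split.
  apply: (le_eps_mul K0) => e e0; have [d d0 Hd] := g_approx e0.
  have [t t0 tK] := small_mul d0 (p0 (c *: h)).
  have tc0 : 0 < t * c by rewrite mulr_gt0.
  have tK2 : t * c * p h <= d by rewrite -mulrA -pc.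
  have [_ _ _ l1 _] := Hd _ _ t0 tK; have [_ _ _ _ u2] := Hd _ _ tc0 tK2.
  by rewrite scalerA in l1; rewrite -(ler_pM2l t0); lra.
apply: (le_eps_mul K0) => e e0; have [d d0 Hd] := g_approx e0.
have [t t0 tK] := small_mul d0 (p0 (c *: h)).
have tc0 : 0 < t * c by rewrite mulr_gt0.
have tK2 : t * c * p h <= d by rewrite -mulrA -pc.
have [_ _ _ _ u1] := Hd _ _ t0 tK; have [_ _ _ l2 _] := Hd _ _ tc0 tK2.
by rewrite scalerA pc in u1; rewrite -(ler_pM2l t0); lra.
Qed.

Lemma convex_derivative : exists dg : V -> R,
  [/\ forall a h k, dg (a *: h + k) = a * dg h + dg k,
      exists2 L, 0 <= L & forall h, `|dg h| <= L * p h &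
      forall eps, 0 < eps -> exists2 d, 0 < d & forall h, p h <= d ->
        D (x + h) /\ `|f (x + h) - f x - dg h| <= eps * p h].
Proof.
have p0 w : 0 <= p w := seminorm_ge0 sp w.
have gA h k : g (h + k) = g h + g k.
  apply/le_anti; rewrite gD/=.
  by have := gD (h + k) (- k); rewrite addrK gN; lra.
have g0 : g 0 = 0 by have := gA 0 0; rewrite addr0; lra.
exists g; split.
- move=> a h k; rewrite gA; congr (_ + _).
  have [a0|a0|->] := ltgtP a 0; [|exact: gZ|by rewrite scale0r g0 mul0r].
  have := @gZ (- a) h; rewrite oppr_gt0 => /(_ a0).
  by rewrite scaleNr gN mulNr => /oppr_inj.
- have [L L0 lipL] := convex_lipschitz; exists L => //.
  suff ub h : g h <= L * p h.
    move=> h; rewrite ler_norml ub andbT.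
    by have := ub (- h); rewrite gN (seminormN sp); lra.
  have [d d0 Hd] := g_approx ltr01.
  have [t t0 tK] := small_mul d0 (p0 h).
  have [C1 _ _ l1 _] := Hd _ _ t0 tK.
  have := lipL _ _ C1 (cyl_center sp x (divr_gt0 r0 (ltr0n R 2))).
  rewrite addrAC subrr add0r (seminormZ sp) gtr0_norm// => lp.
  by rewrite -(ler_pM2l t0); lra.
- move=> eps e0; have [d d0 Hd] := g_approx e0.
  exists d => // h ph; have := Hd h 1 ltr01; rewrite mul1r scale1r => /(_ ph).
  move=> [C1 _ _ l1 u1]; split; first exact: sub.
  rewrite mul1r in l1; rewrite mul1r mulr1 in u1.
  by rewrite ler_norml; apply/andP; split; have := mulr_ge0 (ltW e0) (p0 h); lra.
Qed.

End derivative.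
End bounded_above.
End convex_seminorm.

(** By [convex_midD], the second difference along [h1 + h2] is at most the mean of those along
    [2 *: h1] and [2 *: h2]. The doubling costs half the radius, and the mean
    [(e1 * d + e2 * d) / 2] is [(e1 + e2) * (d / 2)]. *)
Lemma smooth_along_add (R : realType) (V : lmodType R) (p : V -> R)
    (D : set V) (f : V -> R) (H1 H2 H : set V) (e1 e2 : R) (x : V) :
  seminorm p -> conv_closed D -> conv_le D f -> D x ->
  (forall c h, H1 h -> H1 (c *: h)) -> (forall c h, H2 h -> H2 (c *: h)) ->
  (forall h, H h -> exists h1 h2,
    [/\ H1 h1, H2 h2, h = h1 + h2, p h1 <= p h & p h2 <= p h]) ->
  smooth_along p D f H1 e1 x -> smooth_along p D f H2 e2 x ->
  smooth_along p D f H (e1 + e2) x.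
Proof.
move=> sp cD cf Dx HZ1 HZ2 split12 [d1 d10 sm1] [d2 d20 sm2].
pose d := Num.min d1 d2.
have d0 : 0 < d by rewrite lt_min d10.
have dd1 : 0 < d <= d1 by rewrite d0 ge_min lexx.
have dd2 : 0 < d <= d2 by rewrite d0 ge_min lexx orbT.
have {}sm1 := smooth_along_shrink sp cD cf HZ1 Dx dd1 sm1.
have {}sm2 := smooth_along_shrink sp cD cf HZ2 Dx dd2 sm2.
exists (d / 2); first by rewrite divr_gt0.
move=> h /split12[h1 [h2 [Hh1 Hh2 -> ph1 ph2]]] ph.
have p2 k : p k <= d / 2 -> p (2 *: k) <= d.
  by rewrite (seminormZ sp) ger0_norm// ler_pdivlMr// mulrC.
have [D1 D1' sd1] := sm1 _ (HZ1 2 _ Hh1) (p2 _ (le_trans ph1 ph)).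
have [D2 D2' sd2] := sm2 _ (HZ2 2 _ Hh2) (p2 _ (le_trans ph2 ph)).
have [D3 f3] := convex_midD cD cf D1 D2.
rewrite -!scalerN in D1' D2' sd1 sd2.
have [D4 f4] := convex_midD cD cf D1' D2'.
rewrite -opprD in D4 f4; split => //.
move: sd1 sd2; rewrite /second_diff -!scalerN; lra.
Qed.

(** * Baire category for a complete seminorm *)

Section baire.
Context (R : realType) (V : lmodType R) (p : V -> R).
Hypothesis sp : seminorm p.

Definition seminorm_complete := forall u : nat -> V,
  (forall e, 0 < e -> exists N, forall m n,
    (N <= m)%N -> (N <= n)%N -> p (u m - u n) < e) ->
  exists z, forall e, 0 < e -> exists N, forall n, (N <= n)%N -> p (z - u n) < e.

Hypothesis cp : seminorm_complete.

(** Nested cylinders with radii tending to 0 are chosen inside the successive [P n]; a limit of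
    their centres lies in all of them. *)
Lemma seminorm_baire (U : set V) (P : nat -> set V) :
  (forall n x r, 0 < r -> cyl p x r `<=` U -> exists y s,
    [/\ 0 < s, cyl p y s `<=` cyl p x r & cyl p y s `<=` P n]) ->
  forall x r, 0 < r -> cyl p x r `<=` U ->
    exists2 z, cyl p x r z & forall n, P n z.
Proof.
move=> step x0 r0 r0_gt0 CU0.
pose ok (xr : V * R) := 0 < xr.2 /\ cyl p xr.1 xr.2 `<=` U.
have cyl_le x s s' : s <= s' -> cyl p x s `<=` cyl p x s'.
  by move=> ss z /lt_le_trans; apply.
(* The factor 2 is there because the limit is only known to satisfy [p (z - y) <= s]; it then lies
   in the open cylinder of radius [2 * s]. *)
pose next n (xr ys : V * R) := [/\ ok ys, ys.2 <= n.+1%:R^-1,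
  cyl p ys.1 (2 * ys.2) `<=` cyl p xr.1 xr.2 & cyl p ys.1 (2 * ys.2) `<=` P n].
(* The claim is conditional on [ok] so that [choice] gives a total function; the value outside [ok]
   is arbitrary. *)
have ex_next (nxr : nat * (V * R)) : exists ys, ok nxr.2 -> next nxr.1 nxr.2 ys.
  case: nxr => n [x r] /=; have [[/= r_gt0 CU]|nok] := pselect (ok (x, r)); last by exists (x, r).
  have [y [s [s0 ys yP]]] := step n x r r_gt0 CU.
  pose s' := Num.min (s / 2) (n.+1%:R^-1).
  have s'0 : 0 < s' by rewrite lt_min divr_gt0//= invr_gt0.
  have s's : 2 * s' <= s by rewrite mulrC -ler_pdivlMr// ge_min lexx.
  exists (y, s') => _; split => //=.
  - split => //=; apply: subset_trans CU; apply: subset_trans ys.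
    by apply: cyl_le; apply: le_trans s's; rewrite ler_peMl ?ler1n// ltW.
  - by rewrite ge_min lexx orbT.
  - by apply: subset_trans ys; exact: cyl_le.
  - by apply: subset_trans yP; exact: cyl_le.
have [nx nxP] := choice ex_next.
pose u := fix u n := if n is k.+1 then nx (k, u k) else (x0, r0).
have uok n : ok (u n) by elim: n => // n /(nxP (n, _))[].
have uP n : next n (u n) (u n.+1) := nxP (n, u n) (uok n).
have center n : cyl p (u n).1 (u n).2 (u n).1.
  by rewrite /cyl /= subrr (seminorm0 sp); case: (uok n).
have nest n k : cyl p (u (n + k)%N).1 (u (n + k)%N).2 `<=` cyl p (u n).1 (u n).2.
  elim: k => [|k IH]; first by rewrite addn0.
  rewrite addnS; apply: subset_trans IH; have [_ _ + _] := uP (n + k)%N.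
  by apply: subset_trans; apply: cyl_le; have [/ltW] := uok (n + k).+1; lra.
have cen n m : (n <= m)%N -> p ((u m).1 - (u n).1) < (u n).2.
  by move=> nm; apply: (nest n (m - n)%N); rewrite subnKC.
have small e : 0 < e -> exists N, (u N).2 < e.
  move=> e0; have [k] := ltr_add_invr e0; rewrite add0r => ke.
  by exists k.+1; have [_ + _ _] := uP k; move=> /le_lt_trans; exact.
have [|z zP] := cp (u := fun n => (u n).1).
  move=> e e0; have [N Ne] := small (e / 2) (divr_gt0 e0 (ltr0n R 2)).
  exists N => m n Nm Nn; apply: le_lt_trans (seminorm_triangle sp (u N).1 _ _) _.
  rewrite [e]splitr ltrD ?(lt_trans (cen _ _ Nm))// (seminormBC sp).
  by rewrite (lt_trans (cen _ _ Nn)).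
have zu n : p (z - (u n).1) <= (u n).2.
  apply/ler_addgt0Pr => e e0; have [N Nz] := zP e e0.
  apply: le_trans (seminorm_triangle sp (u (maxn N n)).1 _ _) _.
  by rewrite addrC lerD// ltW// ?cen ?Nz ?leq_maxl ?leq_maxr.
have zu2 n : cyl p (u n).1 (2 * (u n).2) z.
  rewrite /cyl /=; apply: le_lt_trans (zu n) _; have [] := uok n.
  by move=> s0 _; rewrite ltr_pMl// ltr1n.
exists z; first by have [_ _ + _] := uP 0%N; apply; exact: zu2.
by move=> n; have [_ _ _] := uP n; apply; exact: zu2.
Qed.

End baire.

(** * Smooth points in a space with a family of seminorms *)

Section seminorm_family.
Context (R : realType) (X : tvsType R) (J : Type) (q : J -> X -> R).
Hypothesis sq : forall j, seminorm (q j).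
Hypothesis q_nbhs : forall j (r : R), 0 < r -> nbhs (0 : X) [set h | q j h < r].
Hypothesis q_basis : forall U, nbhs (0 : X) U ->
  exists j, exists2 r : R, 0 < r & [set h | q j h < r] `<=` U.

Lemma nbhs_cyl j (x : X) (r : R) : 0 < r -> nbhs x (cyl (q j) x r).
Proof.
move=> r0; have := nbhsT x (q_nbhs j r0); apply: filterS => _ [h /= qh <-].
by rewrite /cyl /= addrAC subrr add0r.
Qed.

Lemma nbhs_cylP (x : X) U : nbhs x U ->
  exists j, exists2 r : R, 0 < r & cyl (q j) x r `<=` U.
Proof.
move=> xU; have := nbhsB (- x) xU; rewrite addNr => /q_basis[j [r r0 rU]].
exists j, r => // z /rU [u Uu] /(congr1 (+%R x)).
by rewrite addrA subrr add0r addrC subrK => <-.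
Qed.

Lemma bounded_seminorm j (B : set X) : tvs_bounded B ->
  exists2 K : R, 0 < K & forall b, B b -> q j b < K.
Proof.
move=> /(_ _ (q_nbhs j ltr01))[K K0 HK]; exists K => // b Bb.
have KK : K <= `|K| by exact: ler_norm.
have [u /= qu <-] := HK K KK b Bb.
by rewrite (seminormZ (sq j)) gtr0_norm// gtr_pMr.
Qed.

Section convex.
Context (D : set X) (f : X -> R^o).
Hypothesis oD : open D.
Hypothesis fcont : {within D, continuous f}.
Hypothesis cD : conv_closed D.
Hypothesis cf : conv_le D f.

Lemma cyl_bounded x U : D x -> nbhs x U -> exists j, exists r M : R,
  [/\ 0 < r, cyl (q j) x r `<=` D, cyl (q j) x r `<=` U &
      forall z, cyl (q j) x r z -> f z <= M].
Proof.
move=> Dx xU; have xD : nbhs x D by exact: open_nbhs_nbhs.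
have xf : nbhs x [set z | f z < f x + 1].
  move: fcont; rewrite continuous_open_subspace// => /(_ x (mem_set Dx)).
  move=> xc; apply: (xc [set y : R | y < f x + 1]).
  by apply: open_nbhs_nbhs; split; [exact: open_lt|rewrite /= ltrDl].
have [j [r r0 rU]] := nbhs_cylP (filterI xD (filterI xU xf)).
exists j, r, (f x + 1); split=> // z /rU [Dz [Uz /ltW fz]] //.
Qed.

(** The seminorm is quantified at each point, since the one that controls [f] varies from point to
    point. *)
Definition eps_smooth (eps : R) : set X :=
  [set x | D x /\ exists j, smooth_along (q j) D f setT eps x].

(** Taking interiors makes this a G_delta by construction; [smooth_pointsP] shows that no point
    smooth for every [eps] gets lost. *)
Definition smooth_points : set X :=
  \bigcap_n (eps_smooth (n.+1%:R^-1))^°.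

Lemma smooth_points_Gdelta : Gdelta smooth_points.
Proof. by eexists; last reflexivity; move=> i; exact: open_interior. Qed.

Lemma smooth_points_sub : smooth_points `<=` D.
Proof. by move=> x /(_ 0%N I)/nbhs_singleton[]. Qed.

(* Modulo the kernel of [q i], every [q j] can be made at most [q i]; this makes
   smoothness with respect to [q j] transfer to [q i] when [f] is [q i]-Lipschitz. *)
Hypothesis q_compress : forall i j h, exists2 h', q i (h - h') = 0 & q j h' <= q i h.

Lemma smooth_along_change i j eps x r M : 0 < r -> cyl (q i) x r `<=` D ->
  (forall z, cyl (q i) x r z -> f z <= M) ->
  smooth_along (q j) D f setT eps x -> smooth_along (q i) D f setT eps x.
Proof.
move=> r0 CD fM [d0 d0_gt0 Hd0].
have Dx : D x by apply: CD; exact: (cyl_center (sq i)).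
pose d := Num.min d0 (r / 4).
have d_gt0 : 0 < d by rewrite lt_min d0_gt0 divr_gt0.
have dr : d < r / 2.
  by rewrite gt_min; apply/orP; right; rewrite ltr_pM2l// ltf_pV2 ?posrE// ltr_nat.
have HT (c : R) (h : X) : [set: X] h -> [set: X] (c *: h) by [].
have dd : 0 < d <= d0 by rewrite d_gt0 ge_min lexx.
have Hd := smooth_along_shrink (sq j) cD cf HT Dx dd Hd0.
(* Passing from [h] to [h'] leaves the values of [f] unchanged, while [h'] is small enough for
   [q j]. *)
exists d => // h _ qh; have [h' hh' qjh'] := q_compress i j h.
have qih' : q i h' <= d.
  have := seminorm_triangle (sq i) h h' 0; rewrite !subr0.
  by rewrite (seminormBC (sq i)) hh' add0r => /le_trans; apply.
have [D1 D2 sd] := Hd h' I (le_trans qjh' qh).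
have C k : q i k <= d -> cyl (q i) x (r / 2) (x + k).
  by rewrite /cyl /= addrAC subrr add0r => /le_lt_trans; apply.
have sub w : cyl (q i) x (r / 2) w -> D w.
  by move=> /(cyl_half r0)/CD.
have eqf k k' : q i k <= d -> q i k' <= d -> q i (k - k') = 0 -> f (x + k) = f (x + k').
  move=> qk qk' kk'; apply: (convex_cyl_eq (sq i) cD cf r0 CD fM); [exact: C|exact: C|].
  by rewrite opprD addrACA subrr add0r.
split; [exact/sub/C|by apply/sub/C; rewrite (seminormN (sq i))|].
apply: le_trans sd; rewrite /second_diff (eqf h h')// (eqf (- h) (- h')) ?(seminormN (sq i))//.
by rewrite -opprD (seminormN (sq i)).
Qed.

(** By [smooth_along_change], a single seminorm with [f] bounded above on a cylinder around [x]
    serves all [eps]. Conversely, [smooth_along_near], started from half the constant, puts [x] in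
    each interior. *)
Lemma smooth_pointsP x : smooth_points x <->
  D x /\ exists j, forall eps, 0 < eps -> smooth_along (q j) D f setT eps x.
Proof.
have HT (c : R) (h : X) : [set: X] h -> [set: X] (c *: h) by [].
split=> [Gx|[Dx [j smx]] n _].
  have Dx := smooth_points_sub Gx; split=> //.
  have [i [r [M [r0 CD _ fM]]]] := cyl_bounded Dx filterT.
  exists i => eps e0; have [k] := ltr_add_invr e0; rewrite add0r => ke.
  have [_ [j]] := nbhs_singleton (Gx k I).
  move=> /(smooth_along_change r0 CD fM); apply: smooth_along_mono.
  exact: ltW.
have [i [r [M [r0 CD _ fM]]]] := cyl_bounded Dx filterT.
have n0 : 0 < n.+1%:R^-1 :> R by rewrite invr_gt0.
have n2 : n.+1%:R^-1 / 2 < n.+1%:R^-1 :> R.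
  by rewrite ltr_pdivrMr// ltr_pMr// ltr1n.
have /(smooth_along_change r0 CD fM) sm := smx _ (divr_gt0 n0 (ltr0n R 2)).
have [eta eta0 near] := smooth_along_near (sq i) cD cf r0 CD fM HT n2 sm.
apply: filterS (nbhs_cyl i x (r := Num.min eta r) _); last by rewrite lt_min eta0.
move=> z; rewrite /cyl /= lt_min => /andP[z1 z2].
by split; [exact: CD|exists i; exact: near].
Qed.

Lemma smooth_points_frechet x : smooth_points x -> frechet_differentiable D f x.
Proof.
move=> /[dup] Gx /smooth_pointsP[Dx [j smx]].
have [i [r [M [r0 CD _ fM]]]] := cyl_bounded Dx filterT.
have {}smx eps : 0 < eps -> smooth_along (q i) D f setT eps x.
  by move=> /smx/(smooth_along_change r0 CD fM).
have [dg [dgP [L L0 dgL] dga]] := convex_derivative (sq i) cD cf r0 CD fM smx.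
pose lin : {linear X -> R^o} := HB.pack dg (GRing.isLinear.Build R X R^o *:%R dg dgP).
exists lin.
  move=> y; apply/cvgrPdist_lt => e e0.
  have e1 : 0 < e / (L + 1) by rewrite divr_gt0// ltr_wpDl.
  apply: filterS (nbhs_cyl i y e1) => z; rewrite /cyl /= => zy.
  rewrite distrC -(linearB lin) /=; apply: le_lt_trans (dgL _) _.
  apply: (@le_lt_trans _ _ (L * (e / (L + 1)))); first by rewrite ler_wpM2l// ltW.
  by rewrite mulrA ltr_pdivrMr ?ltr_wpDl// mulrC ltr_pM2l// ltrDl.
move=> B /(bounded_seminorm i)[K K0 BK] e e0.
(* As [q i] is below [K] on [B], this bounds the quotient error by [e / 2], which keeps the supremum
   strictly below [e]. *)
have eK : 0 < e / (2 * K) by rewrite divr_gt0// mulr_gt0.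
have [d d0 Hd] := dga _ eK.
exists (d / K); first by rewrite divr_gt0.
move=> t /andP[t0 td].
have qt b : B b -> q i (t *: b) <= d.
  move=> /BK/ltW bK; rewrite (seminormZ (sq i)).
  rewrite ltr_pdivlMr// in td; apply: le_trans (ltW td).
  by rewrite ler_wpM2l.
split=> [b Bb|]; first by have [] := Hd _ (qt _ Bb).
apply: (@le_lt_trans _ _ (e / 2)%:E); last by rewrite lte_fin ltr_pdivrMr// ltr_pMr// ltr1n.
apply: ge_ereal_sup => _ [b Bb <-]; rewrite lee_fin.
have [_] := Hd _ (qt _ Bb).
have tn0 : t != 0 by rewrite -normr_gt0.
have -> : f (x + t *: b) - f x - dg (t *: b) = t * ((f (x + t *: b) - f x) / t - lin b).
  have -> : dg (t *: b) = t * lin b by exact: (linearZ_LR lin).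
  by rewrite mulrBr [t * (_ / t)]mulrC divfK.
rewrite normrM (seminormZ (sq i)) mulrCA ler_pM2l// => /le_trans; apply.
have -> : e / 2 = e / (2 * K) * K by field; rewrite gt_eqF.
by rewrite ler_pM2l// ltW// BK.
Qed.

End convex.
End seminorm_family.

(** * Normed spaces *)

Section normed.
Context (R : realType) (E : normedModType R).

(** The norm as a one-member family, so that the results on families of seminorms apply to the
    factors. *)
Definition norm_family (_ : unit) (x : E) : R := `|x|.

Lemma norm_family_seminorm j : seminorm (norm_family j).
Proof. by split=> [x y|a x]; [exact: ler_normD|exact: normrZ]. Qed.

Lemma norm_family_nbhs j (r : R) : 0 < r -> nbhs (0 : E) [set h | norm_family j h < r].
Proof. exact: nbhs0_lt. Qed.

Lemma norm_family_basis U : nbhs (0 : E) U ->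
  exists j, exists2 r : R, 0 < r & [set h | norm_family j h < r] `<=` U.
Proof.
move=> /nbhs_norm0P[r /= r0 rU]; exists tt, r => // h /= hr; exact: rU.
Qed.

Lemma norm_family_compress i j h :
  exists2 h', norm_family i (h - h') = 0 & norm_family j h' <= norm_family i h.
Proof. by exists h => //; rewrite /norm_family subrr normr0. Qed.

Context (X : tvsType R) (i : {linear E -> X}).
Hypothesis ic : continuous i.

Lemma bounded_image_unit_ball : tvs_bounded (i @` [set h | `|h| <= 1]).
Proof.
move=> U U0; have : nbhs (0 : E) (i @^-1` U) by apply: ic; rewrite linear0.
move=> /nbhs_norm0P[r /= r0 rU]; exists (2 / r); first by rewrite divr_gt0.
move=> s rs _ [b /= b1 <-].
have s0 : 0 < `|s| by apply: lt_le_trans rs; rewrite divr_gt0.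
exists (i (s^-1 *: b)); last first.
  by rewrite -linearZ scalerA divff ?scale1r// -normr_gt0.
apply: rU; rewrite /= normrZ normfV ltr_pdivrMl//.
apply: (le_lt_trans b1); rewrite ler_pdivrMr// in rs.
by apply: lt_le_trans rs; rewrite ltr1n.
Qed.

(** The image of the unit ball is bounded, so the first-order expansion is uniform on it; adding the
    expansions along [i h] and [- i h] cancels the linear terms. *)
Lemma frechet_second_diff (D : set X) (f : X -> R^o) (x : X) (eps : R) :
  frechet_differentiable D f x -> 0 < eps ->
  exists2 d : R, 0 < d & forall h, `|h| <= d ->
    [/\ D (x + i h), D (x - i h) & second_diff f x (i h) <= eps * d].
Proof.
move=> [f' _ /(_ _ bounded_image_unit_ball (eps / 2))] + eps0.
case=> [|d d0 Hd]; first by rewrite divr_gt0.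
pose t := d / 2; have t0 : 0 < t by rewrite divr_gt0.
have td : 0 < `|t| < d by rewrite gtr0_norm// t0 ltr_pdivrMr// ltr_pMr// ltr1n.
have [DB sup] := Hd t td.
exists t => // h ht; have tn0 : t != 0 by rewrite gt_eqF.
pose b := t^-1 *: h.
have hb : t *: i b = i h by rewrite /b linearZ scalerA divff// scale1r.
have b1 : `|b| <= 1 by rewrite normrZ normfV gtr0_norm// ler_pdivrMl// mulr1.
have B1 : (i @` [set h | `|h| <= 1]) (i b) by exists b.
have B2 : (i @` [set h | `|h| <= 1]) (- i b) by exists (- b); rewrite /= ?normrN ?linearN.
have bound k : (i @` [set h | `|h| <= 1]) k ->
    f (x + t *: k) - f x <= t * f' k + eps / 2 * t.
  move=> Bk; have : (`|(f (x + t *: k) - f x) / t - f' k|%:E < (eps / 2)%:E)%E.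
    by apply: le_lt_trans sup; apply: ereal_sup_ubound; exists k.
  rewrite lte_fin => /ltW /ler_normlW; rewrite lerBlDr ler_pdivrMr//; lra.
have u1 := bound _ B1; have u2 := bound _ B2.
have D1 := DB _ B1; have D2 := DB _ B2.
rewrite scalerN hb in D2 u2; rewrite hb in D1 u1.
split=> //; rewrite /second_diff; move: u2; rewrite linearN; lra.
Qed.

End normed.

(** * The Sigma-product *)

Section sigma.
Context (R : realType) (A : Type) (E : A -> completeNormedModType R).
Local Notation Y := (sigma_product E).
Implicit Types (x y : Y) (a b : A) (F : seq A).

Lemma sigmaD x y a : sigma_val (x + y) a = sigma_val x a + sigma_val y a.
Proof. by []. Qed.

Lemma sigmaN x a : sigma_val (- x) a = - sigma_val x a.
Proof. by []. Qed.

Lemma sigmaZ (c : R) x a : sigma_val (c *: x) a = c *: sigma_val x a.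
Proof. by []. Qed.

Lemma sigma_ext x y : (forall a, sigma_val x a = sigma_val y a) -> x = y.
Proof. by move=> xy; apply/val_inj/functional_extensionality_dep. Qed.

Lemma countable_In F : countable [set a | List.In a F].
Proof.
apply: finite_set_countable; elim: F => [|a F IH] /=.
  by rewrite (_ : [set _ | _] = set0).
have -> : [set b | a = b \/ List.In b F] = [set a] `|` [set b | List.In b F].
  by apply/seteqP; split=> b /=; case=> [->|?]; by [left|right].
by rewrite finite_setU.
Qed.

(** [A] is an arbitrary type, so equality of indices is decided classically and [h] is transported
    along it. *)
Definition sigma_inj_fun a (h : E a) : prod_topology E := fun b =>
  if pselect (a = b) is left e then eq_rect a (fun b => E b : Type) h b e else 0.

Lemma sigma_inj_fun_eq a (h : E a) : sigma_inj_fun h a = h.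
Proof.
rewrite /sigma_inj_fun; case: pselect => // e.
by rewrite (Prop_irrelevance e erefl).
Qed.

Lemma sigma_inj_fun_neq a b (h : E a) : a <> b -> sigma_inj_fun h b = 0.
Proof. by rewrite /sigma_inj_fun; case: pselect. Qed.

Lemma sigma_inj_subproof a (h : E a) : sigma_inj_fun h \in @sigma_pred R A E.
Proof.
apply/mem_set => /=; apply: sub_countable (countable_In [:: a]).
apply: subset_card_le => b /=; have [ab|ab] := pselect (a = b); first by left.
by rewrite sigma_inj_fun_neq// eqxx.
Qed.

Definition sigma_inj a (h : E a) : Y := SigmaProduct (sigma_inj_subproof h).

Lemma sigma_inj_linear a : linear (@sigma_inj a).
Proof.
move=> c h k; apply: sigma_ext => b; rewrite sigmaD sigmaZ /=.
have [<-|ab] := pselect (a = b); first by rewrite !sigma_inj_fun_eq.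
by rewrite !sigma_inj_fun_neq// scaler0 addr0.
Qed.

HB.instance Definition _ a :=
  GRing.isLinear.Build R (E a) Y *:%R (@sigma_inj a) (@sigma_inj_linear a).

Lemma sigma_proj_continuous a : continuous (fun x : Y => sigma_val x a).
Proof.
move=> x W xW; apply: (sigma_val_continuous (x := x)
  (t := [set t : prod_topology E | W (t a)])).
exact: (prod_topology_proj_continuous (x := sigma_val x)).
Qed.

Definition sup_seminorm F x : R :=
  foldr (fun a m => Num.max `|sigma_val x a| m) 0 F.

Lemma sup_seminorm_le F x (r : R) : 0 <= r ->
  (forall a, List.In a F -> `|sigma_val x a| <= r) -> sup_seminorm F x <= r.
Proof.
move=> r0; elim: F => //= a F IH H; rewrite ge_max H ?IH//; last by left.
by move=> b bF; apply: H; right.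
Qed.

Lemma le_sup_seminorm F x a : List.In a F -> `|sigma_val x a| <= sup_seminorm F x.
Proof.
elim: F => //= b F IH [->|aF]; first by rewrite le_max lexx.
by rewrite le_max IH// orbT.
Qed.

Lemma sup_seminorm_ge0 F x : 0 <= sup_seminorm F x.
Proof. by elim: F => //= a F IH; rewrite le_max normr_ge0. Qed.

Lemma sup_seminormP F : seminorm (sup_seminorm F).
Proof.
split=> [x y|c x].
  apply: sup_seminorm_le; first by rewrite addr_ge0// sup_seminorm_ge0.
  by move=> a aF; rewrite (le_trans (ler_normD _ _))// lerD// le_sup_seminorm.
elim: F => /= [|a F IH]; first by rewrite mulr0.
by rewrite IH maxr_pMr// normrZ.
Qed.

Lemma sup_seminorm_nbhs F (r : R) : 0 < r -> nbhs (0 : Y) [set h | sup_seminorm F h < r].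
Proof.
move=> r0; elim: F => [|a F IH] /=.
  by apply: filterS filterT => x _ /=.
have : nbhs (0 : Y) [set x : Y | `|sigma_val x a| < r].
  by apply: (@sigma_proj_continuous a 0 [set h | `|h| < r]); exact: nbhs0_lt.
move=> /filterI/(_ IH); apply: filterS => x [/= xa xF].
by rewrite gt_max xa.
Qed.

(** The filter generated by the boxes converges to 0 coordinatewise, hence in the product, so each
    neighbourhood of 0 there contains a box. *)
Lemma sup_seminorm_basis U : nbhs (0 : Y) U ->
  exists F, exists2 r : R, 0 < r & [set h | sup_seminorm F h < r] `<=` U.
Proof.
move=> [_ [[V oV <-] /= V0 VU]].
pose box (Fr : seq A * R) : set (prod_topology E) :=
  [set x | forall a, List.In a Fr.1 -> `|x a| < Fr.2].
pose FF := filter_from [set Fr : seq A * R | 0 < Fr.2] box.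
have FFF : Filter FF.
  apply: filter_from_filter; first by exists ([::], 1) => /=.
  move=> [F r] [F' r'] /= r0 r'0; exists (F ++ F', Num.min r r') => /=.
    by rewrite lt_min r0.
  by move=> x xF; split=> a aF; have := xF a;
    rewrite lt_min /= => /(_ (List.in_or_app _ _ _ _)); case/(_ _)/andP => //; [left|right].
have : FF --> (0 : prod_topology E).
  apply/cvg_prod_topology => a W /= /nbhs_norm0P[r /= r0 rW].
  by exists ([:: a], r) => //= x xr; apply: rW; apply: xr; left.
move=> /(_ V (open_nbhs_nbhs (conj oV V0)))[[F r] /= r0 FV].
exists F, r => // x /= xr; apply: VU; apply: FV => a aF.
by apply: le_lt_trans xr; exact: le_sup_seminorm.
Qed.

Definition sigma_restrict_fun F x : prod_topology E := fun a =>
  if pselect (List.In a F) then sigma_val x a else 0.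

(** Take for [x'] the element [x] cut off to 0 outside [F]. *)
Lemma sup_seminorm_compress F F' x : exists2 x',
  sup_seminorm F (x - x') = 0 & sup_seminorm F' x' <= sup_seminorm F x.
Proof.
have P : sigma_restrict_fun F x \in @sigma_pred R A E.
  apply/mem_set => /=; apply: sub_countable (countable_In F).
  apply: subset_card_le => a /=; rewrite /sigma_restrict_fun.
  by case: (pselect (List.In a F)) => [//|?] /=; rewrite eqxx.
exists (SigmaProduct P).
  apply/le_anti; rewrite sup_seminorm_ge0 andbT; apply: sup_seminorm_le => // a aF.
  have -> : sigma_val (x - SigmaProduct P) a =
      sigma_val x a - sigma_restrict_fun F x a by [].
  by rewrite /sigma_restrict_fun; case: (pselect (List.In a F)) => [?|//] /=; rewrite subrr normr0.
apply: sup_seminorm_le => [|a aF']; first exact: sup_seminorm_ge0.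
rewrite /= /sigma_restrict_fun; case: (pselect (List.In a F)) => [?|?] /=; first exact: le_sup_seminorm.
by rewrite normr0 sup_seminorm_ge0.
Qed.

(** Limits are taken in the finitely many complete factors indexed by [F]; the value 0 elsewhere
    keeps the limit in the Sigma-product. *)
Lemma sup_seminorm_complete F : seminorm_complete (sup_seminorm F).
Proof.
move=> u uC.
have cvu a : List.In a F -> cvg (sigma_val (u n) a @[n --> \oo]).
  move=> aF; apply: cauchy_cvg; apply: cauchy_exP => e e0.
  have [N Ne] := uC e e0; exists (sigma_val (u N) a); exists N => // n /= Nn.
  rewrite -ball_normE /=; apply: le_lt_trans (Ne N n (leqnn N) Nn).
  exact: (le_sup_seminorm (u N - u n)).
pose z a : E a := if pselect (List.In a F) then lim (sigma_val (u n) a @[n --> \oo]) else 0.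
have P : (z : prod_topology E) \in @sigma_pred R A E.
  apply/mem_set => /=; apply: sub_countable (countable_In F).
  by apply: subset_card_le => a /=; rewrite /z; case: (pselect (List.In a F)) => [//|?] /=; rewrite eqxx.
exists (SigmaProduct P) => e e0.
have [N Ne] := uC (e / 3) (divr_gt0 e0 (ltr0n R 3)); exists N => n Nn.
apply: (@le_lt_trans _ _ (e / 3 + e / 3)); last by lra.
apply: sup_seminorm_le => [|a aF]; first by rewrite addr_ge0// divr_ge0// ltW.
rewrite sigmaD sigmaN /= /z; case: (pselect (List.In a F)) => [?|//] /=.
have /cvgrPdist_lt/(_ _ (divr_gt0 e0 (ltr0n R 3)))[M _ HM] := cvu a aF.
(* [M] depends on the coordinate [a] but [N] does not; the intermediate index [maxn M N] gives a
   bound uniform in [a]. *)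
have /ltW h1 := HM (maxn M N) (leq_maxl M N).
have /ltW h2 := Ne (maxn M N) n (leq_maxr M N) Nn.
apply: le_trans (ler_distD (sigma_val (u (maxn M N)) a) _ _) _.
by rewrite lerD// (le_trans _ h2)//; exact: (le_sup_seminorm (u (maxn M N) - u n)).
Qed.

Lemma sup_seminorm_inj F a (h : E a) : sup_seminorm F (sigma_inj h) <= `|h|.
Proof.
apply: sup_seminorm_le => // b _ /=.
have [<-|ab] := pselect (a = b); first by rewrite sigma_inj_fun_eq.
by rewrite sigma_inj_fun_neq// normr0.
Qed.

Lemma sigma_inj_continuous a : continuous (@sigma_inj a).
Proof.
move=> h U /(nbhs_cylP sup_seminorm_basis)[F [r r0 rU]].
have := nbhs_cyl (@norm_family_nbhs R (E a)) tt h r0; apply: filterS => k kh.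
apply: rU; rewrite /cyl /= -linearB; apply: le_lt_trans kh.
exact: sup_seminorm_inj.
Qed.
End sigma.

(** * Smoothness along the coordinate axes *)

Section partial_derivatives.
Context (R : realType) (A : Type) (E : A -> completeNormedModType R).
Local Notation Y := (sigma_product E).
Local Notation q := (@sup_seminorm R A E).
Context (D : set Y) (f : Y -> R^o).
Hypothesis oD : open D.
Hypothesis fcont : {within D, continuous f}.
Hypothesis cD : conv_closed D.
Hypothesis cf : conv_le D f.

Definition axis a : set Y := range (@sigma_inj R A E a).

Lemma axisZ a (c : R) h : axis a h -> axis a (c *: h).
Proof. by move=> [k _ <-]; exists (c *: k) => //; rewrite linearZ. Qed.

(** Apply the Asplund property of [E a] to the slice of [f] through [x]. Since [a] is in [F], [q F]
    dominates the norm on that axis, so smoothness passes to [q F]. *)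
Lemma dense_partial_smooth F a x (rho : R) : List.In a F ->
  asplund_space (E a) -> D x -> 0 < rho ->
  exists2 h : E a, `|h| < rho & D (x + sigma_inj h) /\
    forall eps, 0 < eps -> smooth_along (q F) D f (axis a) eps (x + sigma_inj h).
Proof.
move=> aF aspE Dx rho0.
pose tr (h : E a) : Y := x + sigma_inj h.
have trc : continuous tr.
  move=> h; apply: (@continuous2_cvg _ _ _ _ (nbhs h) _ (fun=> x) (@sigma_inj R A E a) +%R).
  - exact: (@add_continuous _ (x, sigma_inj h)).
  - exact: cvg_cst.
  - exact: sigma_inj_continuous.
have tr_comb t h k : tr (conv_comb t h k) = conv_comb t (tr h) (tr k).
  by rewrite /tr conv_combD /conv_comb linearD !linearZ.
pose Da : set (E a) := tr @^-1` D.
have oDa : open Da by move/continuousP : trc; apply.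
have Da0 : Da 0 by rewrite /Da /tr /= linear0 addr0.
have [||||G [GD Gd _ Gf]] := aspE Da _ oDa _ (f \o tr).
- by exists 0.
- apply/convex_setP => t h k t01 Dh Dk; rewrite /Da /= tr_comb; exact: cD.
- rewrite continuous_open_subspace// => h /set_mem Dh.
  apply: continuous_comp; first exact: trc.
  by move: fcont; rewrite continuous_open_subspace// => /(_ _ (mem_set Dh)).
- by apply/convex_functionP => t h k t01 Dh Dk; rewrite /= tr_comb; exact: cf.
have [h [Gh /= hrho]] : (G `&` [set h | `|h| < rho]) !=set0.
  by apply: (Gd 0 Da0); exact: nbhs0_lt.
exists h => //; split; first exact: GD.
move=> eps e0.
have idc : continuous (idfun : {linear E a -> E a}) by move=> k; exact: cvg_id.
have [d d0 Hd] := frechet_second_diff idc (Gf h Gh) e0.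
exists d => // _ [k _ <-] qk.
have kd : `|k| <= d.
  by apply: le_trans qk; have := le_sup_seminorm (sigma_inj k) aF; rewrite /= sigma_inj_fun_eq.
have [D1 D2 sd] := Hd k kd.
move: D1 D2 sd; rewrite /second_diff /Da /tr /= linearB linearD !addrA; by split.
Qed.

(** Axes are added one at a time by [smooth_along_add], each contributing one [eps]. *)
Lemma smooth_along_axes F x (r M eps : R) : 0 < r -> cyl (q F) x r `<=` D ->
  (forall z, cyl (q F) x r z -> f z <= M) ->
  (forall a, List.In a F -> smooth_along (q F) D f (axis a) eps x) ->
  smooth_along (q F) D f setT (eps * (size F)%:R) x.
Proof.
move=> r0 CD fM smx.
have sq := @sup_seminormP R A E F.
have Dx : D x by apply: CD; exact: (cyl_center sq).
pose H (s : seq A) : set Y := [set h | forall a, List.In a F ->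
  ~ List.In a s -> sigma_val h a = 0].
have HZ s (c : R) h : H s h -> H s (c *: h).
  by move=> Hh a aF aNs; rewrite sigmaZ Hh// scaler0.
(* The case [s = F] is the claim; [H s] also contains the kernel of [q F], along
   which [f] is locally constant. *)
suff main s : (forall a, List.In a s -> List.In a F) ->
    smooth_along (q F) D f (H s) (eps * (size s)%:R) x.
  have [d d0 Hd] := main F (fun _ => id); exists d => // h _; apply: Hd.
  by move=> a aF /(_ aF).
elim: s => [|a s IH] sF.
  rewrite mulr0; exists (r / 4); first by rewrite divr_gt0.
  move=> h Hh _; have qh : q F h = 0.
    apply/le_anti; rewrite sup_seminorm_ge0 andbT; apply: sup_seminorm_le => // a aF.
    by rewrite Hh// normr0.
  have C k : q F k = 0 -> cyl (q F) x (r / 2) (x + k).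
    by move=> qk; rewrite /cyl /= addrAC subrr add0r qk divr_gt0.
  have sub w : cyl (q F) x (r / 2) w -> D w.
    by move=> /(cyl_half r0)/CD.
  have eqf k : q F k = 0 -> f (x + k) = f x.
    move=> qk; apply: (convex_cyl_eq sq cD cf r0 CD fM); first exact: C.
      by apply: (cyl_center sq); rewrite divr_gt0.
    by rewrite addrAC subrr add0r.
  have qhN : q F (- h) = 0 by rewrite (seminormN sq).
  split; [exact/sub/C|exact/sub/C|rewrite /second_diff !eqf// mul0r; lra].
have aF : List.In a F by apply: sF; left.
have -> : eps * (size (a :: s))%:R = eps + eps * (size s)%:R.
  by rewrite /= -add1n natrD mulrDr mulr1.
have IHs : smooth_along (q F) D f (H s) (eps * (size s)%:R) x.
  by apply: IH => b bs; apply: sF; right.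
apply: (smooth_along_add sq cD cf Dx (axisZ (a := a)) (HZ s) _ (smx a aF) IHs).
(* Removing the coordinate [a] from [h] leaves a vector that vanishes at [a], hence lies in
   [H s]. *)
move=> h Hh; exists (sigma_inj (sigma_val h a)), (h - sigma_inj (sigma_val h a)).
split=> //.
- by exists (sigma_val h a).
- move=> b bF bs; rewrite sigmaD sigmaN /=.
  have [ab|ab] := pselect (a = b).
    by case: b / ab bF bs => _ _; rewrite sigma_inj_fun_eq subrr.
  by rewrite sigma_inj_fun_neq// subr0 Hh//; case.
- by rewrite addrC subrK.
- by apply: le_trans (sup_seminorm_inj _ _) _; exact: le_sup_seminorm.
- apply: sup_seminorm_le => [|b bF]; first exact: sup_seminorm_ge0.
  rewrite sigmaD sigmaN /=; have [ab|ab] := pselect (a = b).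
    by case: b / ab bF => _; rewrite sigma_inj_fun_eq subrr normr0 sup_seminorm_ge0.
  by rewrite sigma_inj_fun_neq// subr0 le_sup_seminorm.
Qed.

(** Baire's argument for [q F], with [P n] the points smooth up to [1 / (n + 1)] along every axis of
    [F]. *)
Lemma dense_smooth F x (r M : R) : (forall a, asplund_space (E a)) ->
  0 < r -> cyl (q F) x r `<=` D -> (forall z, cyl (q F) x r z -> f z <= M) ->
  exists2 z, cyl (q F) x r z &
    forall eps, 0 < eps -> smooth_along (q F) D f setT eps z.
Proof.
move=> aspE r0 CD fM; have sq := @sup_seminormP R A E F.
have shrink y s z : cyl (q F) y s z -> exists2 s', 0 < s' & cyl (q F) z s' `<=` cyl (q F) y s.
  rewrite /cyl /= => zy; exists (s - q F (z - y)); first by rewrite subr_gt0.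
  move=> w /= wz; apply: le_lt_trans (seminorm_triangle sq z _ _) _.
  by rewrite -ltrBrDr.
pose P n : set Y := [set z | forall a, List.In a F ->
  smooth_along (q F) D f (axis a) n.+1%:R^-1 z].
have step n y s : 0 < s -> cyl (q F) y s `<=` cyl (q F) x r -> exists z t,
    [/\ 0 < t, cyl (q F) z t `<=` cyl (q F) y s & cyl (q F) z t `<=` P n].
  (* The axes are treated in turn: a small move along one axis reaches a smooth point, a whole
     cylinder around it stays smooth, and later moves take place inside that cylinder. *)
  suff main l : (forall a, List.In a l -> List.In a F) -> forall y s, 0 < s ->
      cyl (q F) y s `<=` cyl (q F) x r -> exists z t, [/\ 0 < t,
        cyl (q F) z t `<=` cyl (q F) y s & forall w, cyl (q F) z t w ->
          forall a, List.In a l -> smooth_along (q F) D f (axis a) n.+1%:R^-1 w].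
    by move=> s0 ys; have [z [t [t0 zy zP]]] := main F (fun _ => id) y s s0 ys; exists z, t.
  elim: l => [|a l IH] lF {}y {}s s0 ys; first by exists y, s; split.
  have aF : List.In a F by apply: lF; left.
  have Dy : D y by apply/CD/ys; exact: (cyl_center sq).
  have [h hs [Dz smz]] := dense_partial_smooth aF (aspE a) Dy s0.
  set z := y + _ in Dz smz.
  have Cz : cyl (q F) y s z.
    by rewrite /cyl /= /z addrAC subrr add0r; apply: le_lt_trans hs; exact: sup_seminorm_inj.
  have [s1 s10 zs] := shrink _ _ _ Cz.
  have n0 : 0 < n.+1%:R^-1 :> R by rewrite invr_gt0.
  have n2 : n.+1%:R^-1 / 2 < n.+1%:R^-1 :> R.
    by rewrite ltr_pdivrMr// ltr_pMr// ltr1n.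
  have zD : cyl (q F) z s1 `<=` D by move=> w /zs/ys/CD.
  have zM w : cyl (q F) z s1 w -> f w <= M by move=> /zs/ys/fM.
  have [eta eta0 near] := smooth_along_near sq cD cf s10 zD zM (axisZ (a := a)) n2
    (smz _ (divr_gt0 n0 (ltr0n R 2))).
  have mz0 : 0 < Num.min eta s1 by rewrite lt_min eta0.
  have m1 : cyl (q F) z (Num.min eta s1) `<=` cyl (q F) z eta.
    by move=> w; rewrite /cyl /= lt_min => /andP[].
  have m2 : cyl (q F) z (Num.min eta s1) `<=` cyl (q F) y s.
    by move=> w; rewrite /cyl /= lt_min => /andP[_] /zs.
  have [||w [t [t0 wz wP]]] := IH _ z (Num.min eta s1) mz0.
  - by move=> b bl; apply: lF; right.
  - exact: subset_trans ys.
  exists w, t; split=> //; first exact: subset_trans m2.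
  move=> v vw b [<-|bl]; last exact: wP.
  by apply: near; apply/m1/wz.
have [z xz zP] := seminorm_baire sq (@sup_seminorm_complete R A E F) step r0 (@subset_refl _ _).
exists z => // eps e0.
have [s s0 zx] := shrink _ _ _ xz.
have zD : cyl (q F) z s `<=` D by move=> w /zx/CD.
have zM w : cyl (q F) z s w -> f w <= M by move=> /zx/fM.
(* The errors of the [size F] axes add up, so each is kept below [t]. *)
have [t t0 tF] := small_mul e0 (ler0n R (size F)).
have [n] := ltr_add_invr t0; rewrite add0r => nt.
apply: smooth_along_mono tF _.
apply: (smooth_along_axes s0 zD zM) => a aF.
by apply: smooth_along_mono (ltW nt) _; exact: zP.
Qed.

End partial_derivatives.

(** * The two implications *)

Lemma asplund_sigma_product (R : realType) (A : Type)
    (E : A -> completeNormedModType R) :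
  (forall a, asplund_space (E a)) -> asplund_space (sigma_product E).
Proof.
move=> aspE D _ oD /convex_setP cD f fcont /convex_functionP cf.
have sq := @sup_seminormP R A E; have qn := @sup_seminorm_nbhs R A E.
have qb := @sup_seminorm_basis R A E; have qc := @sup_seminorm_compress R A E.
exists (smooth_points (@sup_seminorm R A E) D f); split.
- exact: smooth_points_sub.
- move=> x Dx U xU.
  have [F [r [M [r0 CD CU fM]]]] := cyl_bounded qb oD fcont Dx xU.
  have [z xz zs] := dense_smooth oD fcont cD cf aspE r0 CD fM.
  exists z; split; last exact: CU.
  apply/(smooth_pointsP sq qn qb oD fcont cD cf qc); split; first exact: CD.
  by exists F.
- exact: smooth_points_Gdelta.
- by move=> x; exact: (smooth_points_frechet sq qn qb oD fcont cD cf qc).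
Qed.

(** Pull [f] back along the projection [pr]. Differentiability of [f \o pr] at [y] controls its
    second differences along the axis [a], which are those of [f] at [pr y]. The projected points
    only provide density; the G_delta is [smooth_points]. *)
Lemma asplund_factor (R : realType) (A : Type)
    (E : A -> completeNormedModType R) a :
  asplund_space (sigma_product E) -> asplund_space (E a).
Proof.
move=> aspY D [x0 Dx0] oD /convex_setP cD f fcont /convex_functionP cf.
have sq := @norm_family_seminorm R (E a); have qn := @norm_family_nbhs R (E a).
have qb := @norm_family_basis R (E a); have qc := @norm_family_compress R (E a).
pose pr (y : sigma_product E) : E a := sigma_val y a.
have prc : continuous pr by exact: sigma_proj_continuous.
have pr_inj h : pr (sigma_inj h) = h by rewrite /pr /= sigma_inj_fun_eq.
have pr_inj_sub (U : set (E a)) h : U h -> (pr @^-1` U) (sigma_inj h).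
  by rewrite -{1}(pr_inj h).
have oD' : open (pr @^-1` D) by move/continuousP : prc; apply.
have [||||G [GD Gd _ Gf]] := aspY (pr @^-1` D) _ oD' _ (f \o pr).
- by exists (sigma_inj x0); exact: pr_inj_sub.
- by apply/convex_setP => t h k t01 Dh Dk; exact: (cD t (pr h) (pr k)).
- rewrite continuous_open_subspace// => h /set_mem Dh.
  apply: continuous_comp; first exact: prc.
  by move: fcont; rewrite continuous_open_subspace// => /(_ _ (mem_set Dh)).
- by apply/convex_functionP => t h k t01 Dh Dk; exact: (cf t (pr h) (pr k)).
exists (smooth_points (@norm_family R (E a)) D f); split.
- exact: smooth_points_sub.
- move=> x Dx U xU.
  have [y [Gy Uy]] : (G `&` pr @^-1` U) !=set0.
    apply: (Gd (sigma_inj x)); first exact: pr_inj_sub.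
    by apply: (prc (sigma_inj x) U); rewrite pr_inj.
  exists (pr y); split=> //.
  apply/(smooth_pointsP sq qn qb oD fcont cD cf qc); split; first exact: GD.
  exists tt => eps e0.
  have [d d0 Hd] := frechet_second_diff (@sigma_inj_continuous R A E a) (Gf y Gy) e0.
  exists d => // h _ hd; rewrite /second_diff.
  have -> : pr y + h = pr (y + sigma_inj h) by rewrite -{1}(pr_inj h).
  have -> : pr y - h = pr (y - sigma_inj h) by rewrite -{1}(pr_inj h).
  exact: Hd h hd.
- exact: smooth_points_Gdelta.
- by move=> x; exact: (smooth_points_frechet sq qn qb oD fcont cD cf qc).
Qed.

Theorem proposition2p6 (R : realType) (A : Type)
    (E : A -> completeNormedModType R) :
  asplund_space (sigma_product E) <-> forall a : A, asplund_space (E a).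
Proof.
by split=> [aspY a|]; [exact: asplund_factor aspY|exact: asplund_sigma_product].
Qed.
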